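(* Let $\mu$ be a non-trivial probability measure on the unit circle $\partial\mathbb{D}$ (i.e. its support is infinite), with Verblunsky coefficients $\alpha_n=\alpha_n(d\mu)$, orthonormal polynomials $\varphi_n(z)=\varphi_n(z,d\mu)$ and reversed orthonormal polynomials $\varphi_n^*(z)=\varphi_n^*(z,d\mu)$. Let $0<\gamma<1$, let $\zeta=e^{i\omega}\in\partial\mathbb{D}$, and let $\nu$ be the probability measure $$d\nu=(1-\gamma)\,d\mu+\gamma\,\delta_\omega,$$ where $\delta_\omega$ is the unit point mass at $\zeta=e^{i\omega}$. Then for every $n\ge 0$ the Verblunsky coefficients of $d\nu$ are given by $$\alpha_n(d\nu)=\alpha_n+\frac{(1-|\alpha_n|^2)^{1/2}}{(1-\gamma)\gamma^{-1}+K_n(\zeta)}\;\overline{\varphi_{n+1}(\zeta)}\,\varphi_n^*(\zeta),\qquad\text{where } K_n(\zeta)=\sum_{j=0}^n|\varphi_j(\zeta)|^2 .$$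
   Context: Notation: $\mathbb{D}=\{z\in\mathbb{C}:|z|<1\}$, $\partial\mathbb{D}=\{z\in\mathbb{C}:|z|=1\}$. For a probability measure $\mu$ on $\partial\mathbb{D}$ with infinite support, put $\langle f,g\rangle=\int_{\partial\mathbb{D}}\overline{f}\,g\,d\mu$ and $\|f\|=\langle f,f\rangle^{1/2}$. $\Phi_n(z,d\mu)$ is the monic polynomial of degree $n$ orthogonal to $1,z,\dots,z^{n-1}$ in $L^2(\partial\mathbb{D},d\mu)$, and $\varphi_n=\Phi_n/\|\Phi_n\|$. The reversed polynomials are $\Phi_n^*(z)=z^n\overline{\Phi_n(1/\overline{z})}$ and $\varphi_n^*=\Phi_n^*/\|\Phi_n\|$. The Verblunsky coefficients $\alpha_n=\alpha_n(d\mu)\in\mathbb{D}$, $n\ge0$, are the unique numbers such that $\Phi_{n+1}(z)=z\Phi_n(z)-\overline{\alpha_n}\,\Phi_n^*(z)$; equivalently $\alpha_n=-\overline{\Phi_{n+1}(0)}$. *)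

(* Defs.v *)
From HB Require Import structures.
From mathcomp Require Import all_boot all_order all_algebra.
From mathcomp Require Import complex.
From mathcomp Require Import all_classical all_reals all_analysis.
Import Order.TTheory GRing.Theory Num.Theory.

Set Implicit Arguments.
Unset Strict Implicit.
Unset Printing Implicit Defensive.

Local Open Scope classical_set_scope.
Local Open Scope ring_scope.

Section UnitCircle.
Variable R : realType.

Definition circle := {z : R[i] | `|z| == 1}.

HB.instance Definition _ := Choice.on circle.

Fact circle_one_subproof : `|1 : R[i]| == 1.
Proof. by rewrite normr1. Qed.

HB.instance Definition _ :=
  isPointed.Build circle (exist _ (1 : R[i]) circle_one_subproof).

Definition circle_coord (z : circle) : R * R :=
  (complex.Re (val z), complex.Im (val z)).

(* The Borel sets of the circle: the traces of the Borel sets of the plane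
   [R * R]. *)
HB.instance Definition _ :=
  Measurable.copy circle (g_sigma_algebra_preimageType circle_coord).

Fact expi_subproof (omega : R) : `|(cos omega +i* sin omega)%C| == 1.
Proof. by rewrite normc_def /= cos2Dsin2 sqrtr1. Qed.

(* e^{i omega} *)
Definition expi (omega : R) : circle :=
  exist _ (cos omega +i* sin omega)%C (expi_subproof omega).

End UnitCircle.

Section OPUC.
Variables (R : realType) (mu : probability (circle R) R).
Implicit Types (f g : circle R -> R[i]) (p : {poly R[i]}) (n : nat).

Definition msupport : set (circle R) :=
  [set z | forall e : R, 0 < e ->
    (0 < mu [set w | (`|val w - val z| < e%:C%C)%R])%E].

Definition nontrivial : Prop := infinite_set msupport.

Definition cintegral f : R[i] :=
  ((\int[mu]_z complex.Re (f z)) +i* (\int[mu]_z complex.Im (f z)))%C.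

Definition inner f g : R[i] := cintegral (fun z => (f z)^* * g z).

Definition on_circle p : circle R -> R[i] := fun z => p.[val z].

Definition pnorm p : R[i] := sqrtC (inner (on_circle p) (on_circle p)).

Definition is_monic_OP n p : Prop :=
  [/\ p \is monic, size p = n.+1
    & forall k, (k < n)%N -> inner (on_circle 'X^k) (on_circle p) = 0].

(* [Phi] and [verblunsky] are total: the value 0 is used only when the defining
   property has no solution, which cannot happen for nontrivial [mu]. *)
Definition Phi n : {poly R[i]} := xget 0 [set p | is_monic_OP n p].

Definition phi n : {poly R[i]} := (pnorm (Phi n))^-1 *: Phi n.

(* The polynomial z^n * conj (p (1 / conj z)), for [p] of degree at most [n];
   see [revpE]. It depends on [n] as well as on [p]. *)
Definition revp n p : {poly R[i]} := \poly_(i < n.+1) (p`_(n - i))^*.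

Definition Phi_star n : {poly R[i]} := revp n (Phi n).

Definition phi_star n : {poly R[i]} := (pnorm (Phi n))^-1 *: Phi_star n.

Definition verblunsky n : R[i] :=
  xget 0 [set a : R[i] |
    `|a| < 1 /\ Phi n.+1 = 'X * Phi n - a^* *: Phi_star n].

(* K_n(z), the diagonal of the Christoffel-Darboux kernel. *)
Definition CDdiag n (z : R[i]) : R[i] := \sum_(j < n.+1) `|(phi j).[z]| ^+ 2.

End OPUC.

Lemma revpE (R : realType) (n : nat) (p : {poly R[i]}) (z : R[i]) :
  (size p <= n.+1)%N -> z != 0 ->
  (revp n p).[z] = z ^+ n * (p.[(z^* )^-1])^*.
Proof.
move=> sp z0; rewrite horner_poly (horner_coef_wide _ sp) rmorph_sum mulr_sumr.
rewrite (reindex_inj rev_ord_inj) /=; apply: eq_bigr => i _.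
have lein : (i <= n)%N by rewrite -ltnS.
rewrite subSS subKn// rmorphM rmorphXn /= mulrCA; congr (_ * _).
by rewrite fmorphV /= conjCK exprVn exprB // unitfE.
Qed.

(* Main.v *)
(* On polynomials, <p, q> = int conj(p) q dmu is a positive definite hermitian
   form for which multiplication by z is isometric; this alone gives existence
   of the Phi_n, the Szego recursion and ||Phi_{n+1}||^2 = (1 - |alpha_n|^2)
   ||Phi_n||^2. For nu the form is
   (1 - gamma) <p, q> + gamma conj(p(zeta)) q(zeta), and since K_n(., zeta) reproduces evaluation at zeta on degrees at most n,
     Phi_{n+1}(nu) = Phi_{n+1}
       - Phi_{n+1}(zeta) / ((1 - gamma) / gamma + K_n(zeta)) K_n(., zeta).
   Evaluating at 0, where K_n(0, zeta) = conj(Phi_n^*(zeta)) / ||Phi_n||^2, gives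
   alpha_n(nu) = - conj(Phi_{n+1}(nu)(0)). *)
Require Import Defs.
From HB Require Import structures.
From mathcomp Require Import all_boot all_order all_algebra.
From mathcomp Require Import complex.
From mathcomp Require Import ring lra.
From mathcomp Require Import all_classical all_reals all_analysis.
From mathcomp Require Import measurable_realfun.
Import Order.TTheory GRing.Theory Num.Theory.

Set Implicit Arguments.
Unset Strict Implicit.
Unset Printing Implicit Defensive.

Local Open Scope classical_set_scope.
Local Open Scope ring_scope.

(** * Coefficients of reversed and monic polynomials *)

Section RevPoly.
Context {R : realType}.
Implicit Types p q : {poly R[i]}.

Lemma size_revp n p : (size (revp n p) <= n.+1)%N.
Proof. exact: size_poly. Qed.

Lemma coef0_revp n p : (revp n p)`_0 = (p`_n)^*.
Proof. by rewrite coef_poly subn0. Qed.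

End RevPoly.

Section MonicSize.
Context {A : nzRingType}.
Implicit Types p q : {poly A}.

Lemma monic_coef_size n p : p \is monic -> size p = n.+1 -> p`_n = 1.
Proof. by move=> /monicP mp sp; rewrite -mp lead_coefE sp. Qed.

Lemma size_sub_lead n p q : (size p <= n.+1)%N -> (size q <= n.+1)%N ->
  p`_n = q`_n -> (size (p - q)%R <= n)%N.
Proof.
move=> sp sq pq; apply/leq_sizeP => j; rewrite leq_eqVlt => /predU1P[<-|nj].
  by rewrite coefB pq subrr.
by rewrite coefB !(nth_default 0) ?subrr // (leq_trans _ nj).
Qed.

End MonicSize.

(** * Orthogonal polynomials for an abstract shift-invariant hermitian form *)

Section SzegoForm.
Context {R : realType}.
Implicit Types (p q : {poly R[i]}) (n k : nat).

(** The properties of the inner product on polynomials that the algebra uses, shared by the forms of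
    [mu] and [nu]. [formX] is the trace of |z| = 1 on the circle. *)
Record szego_form (B : {poly R[i]} -> {poly R[i]} -> R[i]) : Prop := SzegoForm {
  formP : forall p a q r, B p (a *: q + r) = a * B p q + B p r;
  formC : forall p q, B q p = (B p q)^*;
  formX : forall p q, B ('X * p) ('X * q) = B p q;
  form_gt0 : forall p, p != 0 -> 0 < B p p }.

(** [is_monic_OP] with the inner product abstracted, so that it also makes sense for [add_mass]. *)
Definition monicOP (B : {poly R[i]} -> {poly R[i]} -> R[i]) n p : Prop :=
  [/\ p \is monic, size p = n.+1 & forall k, (k < n)%N -> B 'X^k p = 0].

Variable B : {poly R[i]} -> {poly R[i]} -> R[i].
Hypothesis hB : szego_form B.

Lemma formDr p q r : B p (q + r) = B p q + B p r.
Proof. by rewrite -[q]scale1r (formP hB) mul1r scale1r. Qed.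

Lemma form0r p : B p 0 = 0.
Proof. by apply: (addIr (B p 0)); rewrite -formDr !add0r. Qed.

Lemma formZr a p q : B p (a *: q) = a * B p q.
Proof. by rewrite -[a *: q]addr0 (formP hB) form0r addr0. Qed.

Lemma formNr p q : B p (- q) = - B p q.
Proof. by rewrite -scaleN1r formZr mulN1r. Qed.

Lemma formBr p q r : B p (q - r) = B p q - B p r.
Proof. by rewrite formDr formNr. Qed.

Lemma form_sumr (I : Type) (s : seq I) (F : I -> {poly R[i]}) p :
  B p (\sum_(i <- s) F i) = \sum_(i <- s) B p (F i).
Proof. exact: (big_morph (B p) (formDr p) (form0r p)). Qed.

Lemma formDl p q r : B (p + q) r = B p r + B q r.
Proof. by rewrite (formC hB r) formDr rmorphD /= -!(formC hB). Qed.

Lemma form0l p : B 0 p = 0.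
Proof. by rewrite (formC hB p) form0r rmorph0. Qed.

Lemma formZl a p q : B (a *: p) q = a^* * B p q.
Proof. by rewrite (formC hB q) formZr rmorphM /= -(formC hB). Qed.

Lemma formBl p q r : B (p - q) r = B p r - B q r.
Proof. by rewrite (formC hB r) formBr rmorphB /= -!(formC hB). Qed.

Lemma form_suml (I : Type) (s : seq I) (F : I -> {poly R[i]}) p :
  B (\sum_(i <- s) F i) p = \sum_(i <- s) B (F i) p.
Proof.
exact: (big_morph (B^~ p) (fun q r => formDl q r p) (form0l p)).
Qed.

Lemma conj_form p : (B p p)^* = B p p.
Proof. by rewrite -(formC hB). Qed.

Lemma form_eq0 p : B p p = 0 -> p = 0.
Proof.
by move=> Bp0; apply/eqP; apply: contraPT Bp0 => /(form_gt0 hB)/lt0r_neq0/eqP.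
Qed.

(** The Gram matrix of the monomials is Toeplitz. *)
Lemma formXnD i j k : B 'X^(k + i) 'X^(k + j) = B 'X^i 'X^j.
Proof. by elim: k => // k IHk; rewrite !addSn !exprS (formX hB). Qed.

Lemma form_Xn_suml n p q : (size p <= n)%N ->
  B p q = \sum_(i < n) (p`_i)^* * B 'X^i q.
Proof.
move=> sp; rewrite -{1}[p](coefK) poly_def form_suml.
rewrite (big_ord_widen n (fun i => B (p`_i *: 'X^i) q) sp) big_mkcond /=.
apply: eq_bigr => i _; rewrite formZl; case: ltnP => // lpi.
by rewrite nth_default // rmorph0 mul0r.
Qed.

(** Reversal exchanges degrees i and n - i and conjugates coefficients; the Toeplitz property
    matches the resulting moments. *)
Lemma form_revp n p k : (size p <= n.+1)%N -> (k <= n)%N ->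
  B 'X^k (revp n p) = (B 'X^(n - k) p)^*.
Proof.
move=> sp kn; rewrite -(formC hB) (form_Xn_suml _ sp) /revp poly_def form_sumr.
rewrite [RHS](reindex_inj rev_ord_inj) /=; apply: eq_bigr => i _.
have lein : (i <= n)%N by rewrite -ltnS.
rewrite formZr subSS; congr (_ * _).
(* Shifting the left moment by n - i and the right one by k turns both into <z^(n-i+k), z^n>. *)
by rewrite -(formXnD k i (n - i)) -(formXnD (n - i) _ k) subnK // subnKC // addnC.
Qed.

Lemma orth_eq0 n p : (size p <= n)%N -> (forall k, (k < n)%N -> B 'X^k p = 0) ->
  p = 0.
Proof.
move=> sp op; apply: form_eq0; rewrite (form_Xn_suml _ sp) big1 // => i _.
by rewrite op // mulr0.
Qed.

(** The leading terms cancel in p - q, which is then orthogonal to a space containing it. *)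
Lemma monicOP_uniq n p q : monicOP B n p -> monicOP B n q -> p = q.
Proof.
move=> [mp sp op] [mq sq oq]; apply/eqP; rewrite -subr_eq0; apply/eqP.
apply: (@orth_eq0 n) => [|k kn]; last by rewrite formBr op // oq // subrr.
by apply: size_sub_lead; rewrite ?sp ?sq // !monic_coef_size.
Qed.

Section OneOP.
Variables (n : nat) (p : {poly R[i]}).
Hypothesis OPp : monicOP B n p.

Let mp : p \is monic. Proof. by case: OPp. Qed.
Let sp : size p = n.+1. Proof. by case: OPp. Qed.
Let pn : p`_n = 1. Proof. exact: monic_coef_size. Qed.

Lemma monicOP_neq0 : p != 0. Proof. exact: monic_neq0. Qed.

Lemma monicOP_gt0 : 0 < B p p. Proof. exact/(form_gt0 hB)/monicOP_neq0. Qed.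

Lemma monicOP_orth q : (size q <= n)%N -> B q p = 0.
Proof.
move=> sq; rewrite (form_Xn_suml _ sq) big1 // => i _.
by case: OPp => _ _ ->; rewrite ?mulr0.
Qed.

(** Subtracting from q its leading coefficient times p leaves degree below n, orthogonal to p. *)
Lemma monicOP_lead q : (size q <= n.+1)%N -> B q p = (q`_n)^* * B p p.
Proof.
move=> sq; apply/eqP; rewrite -subr_eq0 -formZl -formBl; apply/eqP.
apply: monicOP_orth; apply: size_sub_lead => //; last by rewrite coefZ pn mulr1.
by rewrite (leq_trans (size_scale_leq _ _)) // sp.
Qed.

(** Dual to [monicOP_lead]: by [form_revp], the reversed polynomial is orthogonal to z, ..., z^n, so
    pairing with it sees only the constant coefficient. *)
Lemma form_revOP q : (size q <= n.+1)%N -> B q (revp n p) = (q`_0)^* * B p p.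
Proof.
move=> sq; rewrite (form_Xn_suml _ sq) big_ord_recl big1 => [|i _].
  rewrite addr0 form_revp ?sp // subn0 monicOP_lead ?size_polyXn //.
  by rewrite coefXn eqxx rmorph1 mul1r conj_form.
rewrite form_revp ?sp //= monicOP_orth ?rmorph0 ?mulr0 // size_polyXn.
by rewrite /bump /= add1n subnSK ?leq_subr.
Qed.

Lemma coef0_revOP : (revp n p)`_0 = 1.
Proof. by rewrite coef0_revp pn rmorph1. Qed.

Lemma coef0_szego c : ('X * p - c *: revp n p)`_0 = - c.
Proof. by rewrite coefB coefXM coefZ coef0_revOP sub0r mulr1. Qed.

(** Szego recursion: z p and its correction p^* are both orthogonal to z, ..., z^n, and since <1,
    p^*> = ||p||^2 the constant is the one that also gives orthogonality to 1. *)
Lemma monicOP_succ :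
  monicOP B n.+1 ('X * p - (B 1 ('X * p) / B p p) *: revp n p).
Proof.
set c := _ / _.
have sX : size ('X * p) = n.+2 by rewrite mulrC size_mulX ?sp // monicOP_neq0.
have sr : (size (c *: revp n p) < size ('X * p)%R)%N.
  by rewrite sX ltnS (leq_trans (size_scale_leq _ _)) // size_revp.
have sQ : size ('X * p - c *: revp n p) = n.+2.
  by rewrite size_polyDl ?size_polyN.
split=> [|//|[_|k kn]].
- apply/monicP; rewrite lead_coefDl ?size_polyN //.
  by rewrite lead_coefM lead_coefX mul1r; exact/monicP.
- rewrite formBr formZr form_revOP ?expr0 ?size_poly1 //.
  rewrite coef1 /= rmorph1 mul1r /c divfK ?subrr //.
  by rewrite gt_eqF // monicOP_gt0.
- rewrite formBr formZr form_revOP ?size_polyXn // coefXn /= rmorph0 mul0r mulr0.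
  by rewrite exprS (formX hB) monicOP_orth ?size_polyXn // subrr.
Qed.

(* Pythagoras for [z p = (z p - c p^* ) + c p^*], where
   [||z p|| = ||p|| = ||p^*||]. *)
Lemma form_szego c : monicOP B n.+1 ('X * p - c *: revp n p) ->
  B ('X * p - c *: revp n p) ('X * p - c *: revp n p)
    = (1 - `|c| ^+ 2) * B p p.
Proof.
set Q := _ - _ => OPQ.
have sr := size_revp n p.
have rQ : B (revp n p) Q = 0.
  case: OPQ => mQ sQ oQ; rewrite (form_Xn_suml _ sr) big1 // => i _.
  by rewrite oQ ?mulr0.
have rr : B (revp n p) (revp n p) = B p p.
  by rewrite form_revOP // coef0_revOP rmorph1 mul1r.
have : B ('X * p) ('X * p) = B p p by rewrite (formX hB).
have -> : 'X * p = Q + c *: revp n p by rewrite subrK.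
move: rQ; move: Q {OPQ} => Q rQ.
rewrite formDl !formDr !formZl !formZr rQ rr (formC hB (revp n p) Q) rQ rmorph0.
by rewrite !mulr0 addr0 add0r normCK => /(canRL (addrK _)) ->; ring.
Qed.

End OneOP.

Lemma monicOP_ex n : exists p, monicOP B n p.
Proof.
elim: n => [|n [p OPp]]; last by eexists; exact: monicOP_succ OPp.
by exists 1; split; rewrite ?monic1 ?size_poly1.
Qed.

(** * The Christoffel-Darboux kernel *)

Section Kernel.
Variable F : nat -> {poly R[i]}.
Hypothesis OPF : forall n, monicOP B n (F n).

(* [CDkernel n z] is the polynomial w |-> K_(n-1)(w, z), written with the monic
   polynomials to avoid square roots. *)
Definition CDkernel n (z : R[i]) : {poly R[i]} :=
  \sum_(j < n) ((F j).[z]^* / B (F j) (F j)) *: F j.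

Lemma size_CDkernel n z : (size (CDkernel n z) <= n)%N.
Proof.
apply: (leq_trans (size_sum _ _ _)); apply/bigmax_leqP => j _.
by rewrite (leq_trans (size_scale_leq _ _)) //; case: (OPF j) => _ ->.
Qed.

Lemma horner_CDkernel n z :
  (CDkernel n z).[z] = \sum_(j < n) `|(F j).[z]| ^+ 2 / B (F j) (F j).
Proof.
rewrite horner_sum; apply: eq_bigr => j _.
by rewrite hornerZ normCK mulrAC [_ * _^*]mulrC.
Qed.

(** Induction on n: p splits into a multiple of [F n] and a part q of lower degree. [F n] is
    orthogonal to both q and the smaller kernel, so the cross terms vanish. *)
Lemma form_CDkernel n z p : (size p <= n)%N -> B p (CDkernel n z) = (p.[z])^*.
Proof.
elim: n p => [|n IHn] p sp.
  by move: sp; rewrite size_poly_leq0 => /eqP->; rewrite form0l horner0 rmorph0.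
have [mF sF _] := OPF n.
have Fn : (F n)`_n = 1 by exact: monic_coef_size.
have N0 : B (F n) (F n) != 0 by rewrite gt_eqF // (monicOP_gt0 (OPF n)).
set q := p - p`_n *: F n.
have sq : (size q <= n)%N.
  apply: size_sub_lead => //; last by rewrite coefZ Fn mulr1.
  by rewrite (leq_trans (size_scale_leq _ _)) // sF.
have -> : p = q + p`_n *: F n by rewrite subrK.
move: (p`_n) q sq => a q sq.
have KF : B (F n) (CDkernel n z) = 0.
  by rewrite (formC hB) (monicOP_orth (OPF n)) ?rmorph0 ?size_CDkernel.
rewrite /CDkernel big_ord_recr /= -/(CDkernel n z) formDr !formDl IHn //.
rewrite !formZr !formZl KF (monicOP_orth (OPF n) sq) !(mulr0, addr0, add0r).
by rewrite hornerD hornerZ rmorphD rmorphM /= mulrCA divfK.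
Qed.

(* Both sides evaluate [<Phi_n^*, K_n(., z)>]: the left because pairing with
   [Phi_n^*] is evaluation at 0 up to [||Phi_n||^2], the right by the
   reproducing property. *)
Lemma coef0_CDkernel n z :
  (CDkernel n.+1 z)`_0 = ((revp n (F n)).[z])^* / B (F n) (F n).
Proof.
have N0 : B (F n) (F n) != 0 by rewrite gt_eqF // (monicOP_gt0 (OPF n)).
rewrite -(form_CDkernel _ (size_revp n (F n))) (formC hB).
rewrite (form_revOP (OPF n)) ?size_CDkernel //.
by rewrite rmorphM /= conjCK conj_form mulfK.
Qed.

End Kernel.

(** * Adding a point evaluation to the form *)

Section PointMass.
Variables (g z : R[i]) (F : nat -> {poly R[i]}).
Hypotheses (g_gt0 : 0 < g) (g_lt1 : g < 1) (z1 : `|z| = 1).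
Hypothesis OPF : forall n, monicOP B n (F n).

Definition add_mass p q : R[i] := (1 - g) * B p q + g * (p.[z]^* * q.[z]).

(** Shift invariance of the new term is |z| = 1; strict positivity comes from the weight 1 - g > 0
    on [B]. *)
Lemma szego_form_add_mass : szego_form add_mass.
Proof.
have gC : g^* = g by apply: CrealP; exact: gtr0_real.
split.
- by move=> p a q r; rewrite /add_mass (formP hB) hornerD hornerZ; ring.
- move=> p q; rewrite /add_mass rmorphD !rmorphM /= rmorphB rmorph1 /= conjCK !gC.
  by rewrite -(formC hB) [q.[z]^* * _]mulrC.
- move=> p q; rewrite /add_mass (formX hB) !hornerM hornerX rmorphM /=.
  have zz : z^* * z = 1 by rewrite mulrC -normCK z1 expr1n.
  by rewrite mulrACA zz mul1r.
- move=> p p0; apply: ltr_pwDl; first by rewrite mulr_gt0 ?subr_gt0 ?form_gt0.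
  by rewrite mulr_ge0 ?(ltW g_gt0) // mulrC mul_conjC_ge0.
Qed.

(** By the reproducing property, pairing z^k with the candidate F_n - c K gives the conjugate of z^k
    times g F_n(z) - c ((1 - g) + g K(z, z)). The coefficient c is the zero of this expression. *)
Lemma monicOP_add_mass n :
  monicOP add_mass n (F n - ((F n).[z] / ((1 - g) / g + (CDkernel F n z).[z]))
    *: CDkernel F n z).
Proof.
set D := _ / g + _; set c := _ / D.
have [mF sF oF] := OPF n.
have sK : (size (c *: CDkernel F n z) < size (F n))%N.
  by rewrite sF ltnS (leq_trans (size_scale_leq _ _)) // size_CDkernel.
split=> [||k kn].
- by apply/monicP; rewrite lead_coefDl ?size_polyN //; exact/monicP.
- by rewrite size_polyDl ?size_polyN.
have D0 : D != 0.
  rewrite gt_eqF // ltr_pwDl ?divr_gt0 ?subr_gt0 // horner_CDkernel sumr_ge0 //.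
  move=> j _; rewrite divr_ge0 ?exprn_ge0 //; exact/ltW/(monicOP_gt0 (OPF j)).
rewrite /add_mass formBr formZr oF // form_CDkernel ?size_polyXn //.
rewrite hornerD hornerN hornerZ.
have -> : (F n).[z] = c * D by rewrite divfK.
by rewrite /D; field; rewrite gt_eqF.
Qed.

End PointMass.

End SzegoForm.

(** * Bounded measurable real functions *)

Section BoundedMeasurable.
Context d (T : measurableType d) {R : realType}.
Implicit Types f g : T -> R.

(** A class closed under ring operations and integrable for every finite measure, which settles all
    integrability conditions below. *)
Definition bounded_measurable f : Prop :=
  measurable_fun setT f /\ exists M, forall x, `|f x| <= M.

Lemma bounded_measurable_cst (a : R) : bounded_measurable (cst a).
Proof. by split; [exact: measurable_cst | exists `|a|]. Qed.

Lemma bounded_measurableD f g : bounded_measurable f -> bounded_measurable g ->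
  bounded_measurable (fun x => f x + g x).
Proof.
move=> [mf [M fM]] [mg [N gN]]; split; first exact: measurable_funD.
by exists (M + N) => x; rewrite (le_trans (ler_normD _ _)) // lerD.
Qed.

Lemma bounded_measurableM f g : bounded_measurable f -> bounded_measurable g ->
  bounded_measurable (fun x => f x * g x).
Proof.
move=> [mf [M fM]] [mg [N gN]]; split; first exact: measurable_funM.
by exists (M * N) => x; rewrite normrM ler_pM.
Qed.

Lemma bounded_measurableN f : bounded_measurable f ->
  bounded_measurable (fun x => - f x).
Proof.
move=> [mf [M fM]]; split; last by exists M => x; rewrite normrN.
exact: measurable_funN.
Qed.

Lemma bounded_measurable_integrable (mu : {finite_measure set T -> \bar R}) f :
  bounded_measurable f -> mu.-integrable setT (EFin \o f).
Proof.
move=> [mf [M fM]]; apply: measurable_bounded_integrable => //.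
  by rewrite ltey_eq fin_num_measure.
exists M; split; first exact: num_real.
by move=> x Mx y _; exact: le_trans (fM y) (ltW Mx).
Qed.

End BoundedMeasurable.

(** * Complex integrals over the circle *)

Section ComplexIntegral.
Context {R : realType}.
Implicit Types (mu nu : probability (circle R) R) (f g : circle R -> R[i]).

Local Notation Re := (@complex.Re R).
Local Notation Im := (@complex.Im R).

Lemma ReD (x y : R[i]) : Re (x + y) = Re x + Re y.
Proof. by case: x; case: y. Qed.

Lemma ImD (x y : R[i]) : Im (x + y) = Im x + Im y.
Proof. by case: x; case: y. Qed.

Lemma ReM (x y : R[i]) : Re (x * y) = Re x * Re y - Im x * Im y.
Proof. by case: x; case: y. Qed.

Lemma ImM (x y : R[i]) : Im (x * y) = Re x * Im y + Im x * Re y.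
Proof. by case: x; case: y. Qed.

Lemma ReJ (x : R[i]) : Re (x^*) = Re x.
Proof. by case: x. Qed.

Lemma ImJ (x : R[i]) : Im (x^*) = - Im x.
Proof. by case: x. Qed.

Definition cbounded_measurable f : Prop :=
  bounded_measurable (Re \o f) /\ bounded_measurable (Im \o f).

Lemma cbounded_measurable_cst (a : R[i]) : cbounded_measurable (cst a).
Proof. by split; exact: bounded_measurable_cst. Qed.

Lemma cbounded_measurableD f g :
  cbounded_measurable f -> cbounded_measurable g ->
  cbounded_measurable (fun z => f z + g z).
Proof.
move=> [rf jf] [rg jg]; split.
  have -> : Re \o (fun z => f z + g z) = (fun z => (Re \o f) z + (Re \o g) z).
    by apply/funext => z /=; rewrite ReD.
  exact: bounded_measurableD.
have -> : Im \o (fun z => f z + g z) = (fun z => (Im \o f) z + (Im \o g) z).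
  by apply/funext => z /=; rewrite ImD.
exact: bounded_measurableD.
Qed.

Lemma cbounded_measurableM f g :
  cbounded_measurable f -> cbounded_measurable g ->
  cbounded_measurable (fun z => f z * g z).
Proof.
move=> [rf jf] [rg jg]; split.
  have -> : Re \o (fun z => f z * g z) =
      (fun z => (Re \o f) z * (Re \o g) z + - ((Im \o f) z * (Im \o g) z)).
    by apply/funext => z /=; rewrite ReM.
  apply: bounded_measurableD; first exact: bounded_measurableM.
  exact/bounded_measurableN/bounded_measurableM.
have -> : Im \o (fun z => f z * g z) =
    (fun z => (Re \o f) z * (Im \o g) z + (Im \o f) z * (Re \o g) z).
  by apply/funext => z /=; rewrite ImM.
by apply: bounded_measurableD; exact: bounded_measurableM.
Qed.

Lemma cbounded_measurableJ f : cbounded_measurable f ->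
  cbounded_measurable (fun z => (f z)^*).
Proof.
move=> [rf jf]; split.
  have -> // : Re \o (fun z => (f z)^*) = Re \o f.
  by apply/funext => z /=; rewrite ReJ.
have -> : Im \o (fun z => (f z)^*) = (fun z => - (Im \o f) z).
  by apply/funext => z /=; rewrite ImJ.
exact: bounded_measurableN.
Qed.

Lemma measurable_circle_coord : measurable_fun setT (@circle_coord R).
Proof. by move=> _ B mB; exists B. Qed.

Lemma circle_val_normE (z : circle R) : `|val z| = 1.
Proof. exact/eqP/(valP z). Qed.

(** The sigma-algebra is generated by the coordinates, and Re^2 + Im^2 = 1 bounds each of them by
    1. *)
Lemma cbounded_measurable_val : cbounded_measurable (fun z => val z).
Proof.
have nz (z : circle R) : Re (val z) ^+ 2 + Im (val z) ^+ 2 = 1.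
  by apply: complexI; rewrite add_Re2_Im2 circle_val_normE expr1n.
split; split.
- exact: (measurableT_comp measurable_fst measurable_circle_coord).
- exists 1 => z /=; rewrite -sqrtr1 -(nz z) -sqrtr_sqr ler_wsqrtr // lerDl.
  exact: sqr_ge0.
- exact: (measurableT_comp measurable_snd measurable_circle_coord).
- exists 1 => z /=; rewrite -sqrtr1 -(nz z) -sqrtr_sqr ler_wsqrtr // lerDr.
  exact: sqr_ge0.
Qed.

Lemma cbounded_measurable_on_circle (p : {poly R[i]}) :
  cbounded_measurable (on_circle p).
Proof.
elim/poly_ind: p => [|p a IHp].
  have -> : on_circle (0 : {poly R[i]}) = cst 0.
    by apply/funext => z; rewrite /on_circle horner0.
  exact: cbounded_measurable_cst.
have -> : on_circle (p * 'X + a%:P) = (fun z => on_circle p z * val z + a).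
  by apply/funext => z; rewrite /on_circle !hornerE.
apply: cbounded_measurableD; last exact: cbounded_measurable_cst.
exact: cbounded_measurableM IHp cbounded_measurable_val.
Qed.

Lemma cintegralD mu f g : cbounded_measurable f -> cbounded_measurable g ->
  cintegral mu (fun z => f z + g z) = cintegral mu f + cintegral mu g.
Proof.
move=> [rf jf] [rg jg]; rewrite /cintegral.
under eq_Rintegral do rewrite ReD.
under [X in (_ +i* X)%C]eq_Rintegral do rewrite ImD.
by rewrite !RintegralD //; exact: bounded_measurable_integrable.
Qed.

Lemma cintegralZ mu (a : R[i]) f : cbounded_measurable f ->
  cintegral mu (fun z => a * f z) = a * cintegral mu f.
Proof.
move=> [rf jf]; rewrite /cintegral.
have intZ (b : R) h : bounded_measurable h ->
    mu.-integrable setT (EFin \o (fun z => b * h z)).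
  move=> bh; apply: bounded_measurable_integrable.
  by apply: bounded_measurableM => //; exact: bounded_measurable_cst.
have := (intZ _ _ rf, intZ _ _ jf).
under eq_Rintegral do rewrite ReM.
under [X in (_ +i* X)%C]eq_Rintegral do rewrite ImM.
move=> i; rewrite RintegralB ?RintegralD //; try by apply: intZ.
rewrite !RintegralZl //; try exact: bounded_measurable_integrable.
by case: a {i}.
Qed.

Lemma cintegralJ mu f : cbounded_measurable f ->
  cintegral mu (fun z => (f z)^*) = (cintegral mu f)^*.
Proof.
move=> [rf jf]; rewrite /cintegral.
under eq_Rintegral do rewrite ReJ.
under [X in (_ +i* X)%C]eq_Rintegral do rewrite ImJ -mulN1r.
rewrite RintegralZl //; last exact: bounded_measurable_integrable.
by rewrite mulN1r.
Qed.

(** * Integration against a measure with an added point mass *)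

Section PointMass.
Variables (mu nu : probability (circle R) R) (gamma omega : R).
Hypotheses (gamma_ge0 : 0 <= gamma) (gamma_le1 : gamma <= 1).
Hypothesis nuE : forall A : set (circle R), measurable A ->
  nu A = ((1 - gamma)%:E * mu A + gamma%:E * \d_(expi omega) A)%E.

(** Nonnegative functions allow the integral to be split along the sum of measures in the extended
    reals; finiteness brings the identity back to the reals. *)
Lemma ge0_Rintegral_point_mass (f : circle R -> R) :
  bounded_measurable f -> (forall z, 0 <= f z) ->
  \int[nu]_z f z = (1 - gamma) * \int[mu]_z f z + gamma * f (expi omega).
Proof.
move=> bf f0; have [mf _] := bf.
have ef : measurable_fun setT (EFin \o f) by exact/measurable_EFinP.
have e0 z : setT z -> (0 <= (EFin \o f) z)%E by rewrite lee_fin.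
have h1 : 0 <= 1 - gamma by rewrite subr_ge0.
rewrite /Rintegral (eq_measure_integral (measure_add
  (mscale (NngNum h1) mu) (mscale (NngNum gamma_ge0) (\d_(expi omega))))).
  rewrite ge0_integral_measure_add // !ge0_integral_mscale //= integral_dirac //.
  rewrite diracT mul1e fineD //=.
    by rewrite fineM // integrable_fin_num // bounded_measurable_integrable.
  by rewrite fin_numM // integrable_fin_num // bounded_measurable_integrable.
by move=> A mA _; apply: (eq_trans (nuE mA)); apply: esym; exact: measure_addE.
Qed.

(** Adding a bound M makes f nonnegative; M then cancels because all the measures have mass 1 and
    the weights sum to 1. *)
Lemma Rintegral_point_mass (f : circle R -> R) : bounded_measurable f ->
  \int[nu]_z f z = (1 - gamma) * \int[mu]_z f z + gamma * f (expi omega).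
Proof.
move=> bf; have [mf [M fM]] := bf.
have bM : bounded_measurable (cst M : circle R -> R).
  exact: bounded_measurable_cst.
have bfM := bounded_measurableD bf bM.
have := ge0_Rintegral_point_mass bfM.
rewrite !RintegralD //; try exact: bounded_measurable_integrable.
have intM (P : probability (circle R) R) : \int[P]_z (cst M z) = M.
  rewrite Rintegral_cst // -[RHS]mulr1; congr (_ * _).
  by have := congr1 fine (probability_setT P); apply: etrans.
rewrite !intM => h.
have : \int[nu]_z f z + M =
    (1 - gamma) * (\int[mu]_z f z + M) + gamma * (f (expi omega) + M).
  by apply: h => z /=; have := fM z; rewrite ler_norml => /andP[? _]; lra.
by lra.
Qed.

Lemma cintegral_point_mass f : cbounded_measurable f ->
  cintegral nu f =
    (1 - gamma%:C%C) * cintegral mu f + gamma%:C%C * f (expi omega).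
Proof.
move=> [rf jf]; rewrite /cintegral.
rewrite (Rintegral_point_mass rf) (Rintegral_point_mass jf).
rewrite -[1 in RHS](rmorph1 (real_complex R)) -rmorphB.
by rewrite /=; case: (f (expi omega)) => a b; simpc.
Qed.

End PointMass.

(** * Positivity of the norm of a nonzero polynomial *)

Lemma bounded_measurable_sqr_normc f : cbounded_measurable f ->
  bounded_measurable (fun z => Re (f z) ^+ 2 + Im (f z) ^+ 2).
Proof.
move=> [rf jf].
exact: (bounded_measurableD (bounded_measurableM rf rf)
                            (bounded_measurableM jf jf)).
Qed.

Lemma cbounded_measurable_bound f : cbounded_measurable f ->
  exists2 M : R, 0 < M & forall z, `|f z| <= M%:C%C.
Proof.
(* M + N bounds |Re| + |Im|; the extra 1 makes the bound positive, hence usable as a divisor. *)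
move=> [[_ [M fM]] [_ [N fN]]]; exists (M + N + 1).
  have := le_trans (normr_ge0 _) (fM point).
  by have := le_trans (normr_ge0 _) (fN point); lra.
move=> z; rewrite [f z]complexE (le_trans (ler_normD _ _)) //.
rewrite normrM complexiE normCi mul1r !normc_def /= !expr0n /= !addr0.
rewrite !sqrtr_sqr -rmorphD lecR /=.
by have := fM z; have := fN z; rewrite /=; lra.
Qed.

(** For e > 0 the ball is the preimage of ]-oo, e^2[ under |w - z|^2; otherwise it is empty. *)
Lemma measurable_ball_circle (z : circle R) (e : R) :
  measurable [set w : circle R | `|val w - val z| < e%:C%C].
Proof.
have [e0|e0] := ltP 0 e; last first.
  rewrite (_ : [set _ | _] = set0) //; apply/seteqP; split=> // w /= wz.
  have := le_lt_trans (normr_ge0 _) wz.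
  by rewrite -(rmorph0 (real_complex R)) ltcR ltNge e0.
have [mg _] : bounded_measurable (fun w : circle R =>
    Re (on_circle ('X - (val z)%:P) w) ^+ 2 +
    Im (on_circle ('X - (val z)%:P) w) ^+ 2).
  exact/bounded_measurable_sqr_normc/cbounded_measurable_on_circle.
have := mg measurableT _ (measurable_itv `]-oo, (e ^+ 2)[).
have sqrtlt a : (Num.sqrt a < e) = (a < e ^+ 2).
  by rewrite -[in LHS](gtr0_norm e0) -sqrtr_sqr ltr_sqrt ?exprn_gt0.
rewrite setTI; congr (measurable _); apply/seteqP; split=> w /=;
  by rewrite /on_circle hornerXsubC in_itv /= normc_def ltcR sqrtlt.
Qed.

(** A nonzero polynomial splits over [R[i]] into finitely many linear factors, so its roots cannot
    cover an infinite set. *)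
Lemma infinite_not_all_root (S : set (circle R)) (p : {poly R[i]}) :
  infinite_set S -> p != 0 -> exists2 z, S z & p.[val z] != 0.
Proof.
move=> infS p0; apply: contrapT => noz; apply: infS.
have [r pE] := closed_field_poly_normal p.
apply: (@sub_finite_set _ _ ((fun z : circle R => val z) @^-1` [set` r])).
  move=> z Sz /=; apply: contrapT => zr; apply: noz; exists z => //.
  rewrite pE hornerZ mulf_neq0 ?lead_coef_eq0 //.
  by rewrite -rootE root_prod_XsubC; apply/negP.
apply: finite_preimage; last exact: finite_seq.
by move=> x y _ _; exact: val_inj.
Qed.

(** Write p - p(z) = q (X - z) with |q| <= M on the circle. A zero w of p satisfies |p(z)| <= M |w -
    z|, so the radius |p(z)| / M works. *)
Lemma on_circle_neq0_near (p : {poly R[i]}) (z : circle R) :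
  p.[val z] != 0 ->
  exists2 e : R, 0 < e & forall w : circle R,
    `|val w - val z| < e%:C%C -> p.[val w] != 0.
Proof.
move=> pz; have : root (p - p.[val z]%:P) (val z).
  by rewrite /root hornerD hornerN hornerC subrr.
move=> /factor_theorem[q pE].
have [M M0 qM] := cbounded_measurable_bound (cbounded_measurable_on_circle q).
pose c := Re `|p.[val z]|.
have cE : `|p.[val z]| = c%:C%C by rewrite /c normc_def.
have c0 : 0 < c by rewrite -ltcR -cE normr_gt0.
exists (c / M) => [|w wz]; first by rewrite divr_gt0.
apply/eqP => pw; have := congr1 (fun r => `|r.[val w]|) pE.
rewrite hornerM hornerXsubC hornerD hornerN hornerC pw sub0r normrN cE normrM.
move=> cqw; have : c%:C%C < c%:C%C :> R[i].
  rewrite {1}cqw; apply: le_lt_trans (_ : M%:C%C * `|val w - val z| < _).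
    by rewrite ler_wpM2r ?qM.
  have MC : 0 < M%:C%C :> R[i] by rewrite ltcR.
  by rewrite mulrC -ltr_pdivlMr // -fmorph_div.
by rewrite ltxx.
Qed.

(** Were the integral zero, p would vanish off a null set N. Some support point has p nonzero on a
    ball around it; that ball lies in N yet has positive measure. *)
Lemma Rintegral_sqr_normc_gt0 mu (p : {poly R[i]}) : nontrivial mu -> p != 0 ->
  0 < \int[mu]_z (Re (on_circle p z) ^+ 2 + Im (on_circle p z) ^+ 2).
Proof.
move=> infmu p0; set h := fun z => _ + _.
have bh : bounded_measurable h.
  exact/bounded_measurable_sqr_normc/cbounded_measurable_on_circle.
have h0 z : 0 <= h z by rewrite addr_ge0 ?sqr_ge0.
have I0 : 0 <= \int[mu]_z h z by exact: Rintegral_ge0.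
rewrite lt_def I0 andbT; apply/negP => /eqP inth0.
have [mh _] := bh.
have eh : measurable_fun setT (EFin \o h) by exact/measurable_EFinP.
have /(ae_eq_integral_abs mu measurableT eh)[N [mN N0 hN]] :
    (\int[mu]_z `|(EFin \o h) z| = 0)%E.
  under eq_integral do rewrite /= ger0_norm //.
  rewrite -[LHS]fineK; first by congr (_%:E).
  by apply: integrable_fin_num => //; exact: bounded_measurable_integrable.
have [z Sz pz] := infinite_not_all_root infmu p0.
have [e e0 pe] := on_circle_neq0_near pz.
have := Sz e e0; apply/negP; rewrite -leNgt -N0.
apply: le_measure; rewrite ?inE //; first exact: measurable_ball_circle.
move=> w /pe pw; apply: hN => /= /(_ I)[] hw.
move/negP: pw; apply; apply/eqP.
have [r j] : Re (on_circle p w) = 0 /\ Im (on_circle p w) = 0.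
  move/eqP: hw; rewrite paddr_eq0 ?sqr_ge0 // !sqrf_eq0.
  by move=> /andP[/eqP-> /eqP->].
by rewrite [LHS]complexE -/(on_circle p w) r j mulr0 addr0.
Qed.

(** * The inner product of a nontrivial measure as a Szego form *)

Definition poly_inner mu (p q : {poly R[i]}) : R[i] :=
  inner mu (on_circle p) (on_circle q).

Lemma cbounded_measurable_inner (p q : {poly R[i]}) :
  cbounded_measurable (fun z => (on_circle p z)^* * on_circle q z).
Proof.
apply: cbounded_measurableM; last exact: cbounded_measurable_on_circle.
exact/cbounded_measurableJ/cbounded_measurable_on_circle.
Qed.

Lemma szego_form_inner mu : nontrivial mu -> szego_form (poly_inner mu).
Proof.
move=> infmu; split.
- move=> p a q r; rewrite /poly_inner /inner.
  rewrite -cintegralZ; last exact: cbounded_measurable_inner.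
  rewrite -cintegralD; last exact: cbounded_measurable_inner.
    congr cintegral; apply/funext => z.
    by rewrite /on_circle hornerD hornerZ; ring.
  apply: cbounded_measurableM; last exact: cbounded_measurable_inner.
  exact: cbounded_measurable_cst.
- move=> p q; rewrite /poly_inner /inner.
  rewrite -cintegralJ; last exact: cbounded_measurable_inner.
  by congr cintegral; apply/funext => z; rewrite rmorphM /= conjCK mulrC.
- move=> p q; congr cintegral; apply/funext => z.
  rewrite /on_circle !hornerM hornerX rmorphM mulrACA /= [_^* * val z]mulrC.
  by rewrite -normCK circle_val_normE expr1n mul1r.
- move=> p p0; rewrite /poly_inner /inner.
  have -> : (fun z => (on_circle p z)^* * on_circle p z) =
      (fun z => (Re (on_circle p z) ^+ 2 + Im (on_circle p z) ^+ 2)%:C%C).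
    by apply/funext => z; rewrite add_Re2_Im2 normCK mulrC.
  rewrite /cintegral /= Rintegral_cst // mul0r.
  by rewrite ltcR; exact: Rintegral_sqr_normc_gt0.
Qed.

End ComplexIntegral.

(** * Verblunsky coefficients and norms *)

Section Verblunsky.
Context {R : realType} (mu : probability (circle R) R).
Hypothesis hB : szego_form (poly_inner mu).

Lemma PhiP n : monicOP (poly_inner mu) n (Phi mu n).
Proof.
have [p OPp] := monicOP_ex hB n.
(* Existence rules out the default value 0 of [xget]; [is_monic_OP mu] and [monicOP (poly_inner mu)]
   are convertible. *)
exact: (@xgetPex _ 0 [set p | is_monic_OP mu n p] (ex_intro _ p OPp)).
Qed.

Lemma Phi_unique n p : monicOP (poly_inner mu) n p -> Phi mu n = p.
Proof. exact: (monicOP_uniq hB (PhiP n)). Qed.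

Lemma Phi_norm_gt0 n : 0 < poly_inner mu (Phi mu n) (Phi mu n).
Proof. exact: (monicOP_gt0 hB (PhiP n)). Qed.

Lemma Phi_succ : exists c : R[i]^nat,
  forall n, Phi mu n.+1 = 'X * Phi mu n - c n *: Phi_star mu n.
Proof.
exists (fun n => poly_inner mu 1 ('X * Phi mu n) /
  poly_inner mu (Phi mu n) (Phi mu n)) => n.
exact/Phi_unique/(monicOP_succ hB)/PhiP.
Qed.

(** The witness is the conjugate of the Szego constant c; |c| < 1 because (1 - |c|^2) ||Phi_n||^2 =
    ||Phi_(n+1)||^2 > 0. *)
Lemma verblunskyP n : `|verblunsky mu n| < 1 /\
  Phi mu n.+1 = 'X * Phi mu n - (verblunsky mu n)^* *: Phi_star mu n.
Proof.
apply: (@xgetPex _ 0 [set a : R[i] | `|a| < 1 /\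
  Phi mu n.+1 = 'X * Phi mu n - a^* *: Phi_star mu n]).
have [c cP] := Phi_succ; exists (c n)^* => /=; rewrite conjCK; split=> //.
have := Phi_norm_gt0 n.+1; have := PhiP n.+1; rewrite cP => OPQ.
rewrite (form_szego hB (PhiP n) OPQ) pmulr_lgt0 ?Phi_norm_gt0 // subr_gt0.
by rewrite norm_conjC expr_lt1.
Qed.

Lemma verblunskyE n : verblunsky mu n = - ((Phi mu n.+1)`_0)^*.
Proof.
have [_ ->] := verblunskyP n.
by rewrite (coef0_szego (PhiP n)) rmorphN /= opprK conjCK.
Qed.

Lemma Phi_norm_succ n : poly_inner mu (Phi mu n.+1) (Phi mu n.+1) =
  (1 - `|verblunsky mu n| ^+ 2) * poly_inner mu (Phi mu n) (Phi mu n).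
Proof.
have [_ E] := verblunskyP n; have := PhiP n.+1; rewrite E => OPQ.
by rewrite (form_szego hB (PhiP n) OPQ) norm_conjC.
Qed.

Lemma pnorm_succ n :
  pnorm mu (Phi mu n.+1) =
  sqrtC (1 - `|verblunsky mu n| ^+ 2) * pnorm mu (Phi mu n).
Proof.
have [a1 _] := verblunskyP n.
have := Phi_norm_succ n; rewrite /pnorm /poly_inner => ->.
rewrite rootCMl // subr_ge0 expr_le1 //; exact: ltW.
Qed.

(** Squaring removes the roots in the normalisation. The sum K_n includes j = n, hence the index
    [n.+1] of the kernel. *)
Lemma CDdiagE n z :
  CDdiag mu n z = (CDkernel (poly_inner mu) (Phi mu) n.+1 z).[z].
Proof.
rewrite horner_CDkernel; apply: eq_bigr => j _.
have N0 := ltW (Phi_norm_gt0 j).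
rewrite /phi hornerZ normrM exprMn mulrC; congr (_ * _).
by rewrite normrV ?unitfE ?sqrtC_eq0 ?gt_eqF ?Phi_norm_gt0 // exprVn
  ger0_norm ?sqrtC_ge0 // sqrtCK.
Qed.

End Verblunsky.

(** * The point mass formula *)

Theorem theorem2p1 (R : realType) (mu nu : probability (circle R) R)
    (gamma omega : R)
    (mu_nontrivial : nontrivial mu)
    (gamma_gt0 : 0 < gamma) (gamma_lt1 : gamma < 1)
    (nuE : forall A : set (circle R), measurable A ->
      nu A = ((1 - gamma)%:E * mu A + gamma%:E * \d_(expi omega) A)%E)
    (n : nat) :
  let zeta : R[i] := val (expi omega) in
  verblunsky nu n =
    verblunsky mu n +
    sqrtC (1 - `|verblunsky mu n| ^+ 2)
      / ((1 - gamma%:C%C) * (gamma%:C%C)^-1 + CDdiag mu n zeta)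
    * (phi mu n.+1).[zeta]^* * (phi_star mu n).[zeta].
Proof.
move=> zeta; set g : R[i] := gamma%:C%C.
have hmu := szego_form_inner mu_nontrivial.
have g0 : 0 < g by rewrite ltcR.
have g1 : g < 1 by rewrite -(rmorph1 (real_complex R)) ltcR.
have zeta1 : `|zeta| = 1 by exact: circle_val_normE.
have nu_form : poly_inner nu = add_mass (poly_inner mu) g zeta.
  apply/funext => p; apply/funext => q.
  have := cintegral_point_mass (ltW gamma_gt0) (ltW gamma_lt1) nuE
    (cbounded_measurable_inner p q).
  exact.
(* Positivity for [nu] is inherited from [mu] through [add_mass], without examining the support of
   [nu]. *)
have hnu : szego_form (poly_inner nu).
  by rewrite nu_form; exact: szego_form_add_mass.
have OPmu := PhiP hmu.
(* Degree n + 1 makes the kernel K_n, as the formula requires. *)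
have := monicOP_add_mass hmu zeta g0 g1 OPmu n.+1.
rewrite -nu_form => /(Phi_unique hnu) PhiE.
rewrite (verblunskyE hnu) PhiE coefB coefZ (coef0_CDkernel hmu OPmu) -CDdiagE //.
rewrite rmorphB opprB addrC -(verblunskyE hmu); congr (_ + _).
set D := _ / g + _.
have D_gt0 : 0 < D.
  apply: ltr_pwDl; first by rewrite divr_gt0 ?subr_gt0.
  by apply: sumr_ge0 => j _; rewrite exprn_ge0.
have N0 := Phi_norm_gt0 hmu n.
have [a1 _] := verblunskyP hmu n.
have rho_gt0 : 0 < sqrtC (1 - `|verblunsky mu n| ^+ 2).
  by rewrite sqrtC_gt0 subr_gt0 expr_lt1.
have s_gt0 : 0 < pnorm mu (Phi mu n) by rewrite sqrtC_gt0.
(* With s = ||Phi_n|| and ||Phi_(n+1)|| = rho s, the factor rho cancels on the right; both sides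
   become the conjugate of Phi_(n+1)(zeta) times Phi_n^*(zeta) / (D s^2). Positivity makes s, rho
   and D self-conjugate. *)
have -> : poly_inner mu (Phi mu n) (Phi mu n) =
    pnorm mu (Phi mu n) * pnorm mu (Phi mu n).
  by rewrite -expr2 sqrtCK.
rewrite /phi /phi_star !hornerZ (pnorm_succ hmu).
rewrite !(rmorphM, fmorphV) /= conjCK.
rewrite !(conj_Creal (ger0_real (ltW s_gt0))).
rewrite !(conj_Creal (ger0_real (ltW rho_gt0))).
rewrite (conj_Creal (ger0_real (ltW D_gt0))) /Phi_star.
by field; rewrite !gt_eqF.
Qed.
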